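(* Let $(V,E,\mathbf{w})$ be a connected weighted graph, where $E=\{e_1,e_2,\dots,e_m\}$ is the set of all edges, $\mathbf{w}=(w_{e_1},\dots,w_{e_m})$, and $w_{e_i}$ is the weight of the edge $e_i$. For each $e_i=x_iy_i$ let $$\rho_{e_i}=\min_{\gamma\in\Gamma_{e_i}}\sum_{e_k\in\gamma}w_{e_k},$$ where $\Gamma_{e_i}$ is the set of all paths connecting $x_i$ and $y_i$, and let $\kappa_{e_i}$ be the Lin-Lu-Yau Ricci curvature of $e_i$. Then for any initial weight $\mathbf{w}_0=(w_{0,1},\dots,w_{0,m})\in\mathbb{R}^m_+$, the Ricci flow $$\begin{cases}\dfrac{d}{dt}w_{e_i}(t)=-\kappa_{e_i}(t)\,\rho_{e_i}(t)\\[1ex] w_{e_i}(0)=w_{0,i}\end{cases}\qquad i=1,2,\dots,m,$$ has a unique solution $\mathbf{w}(t)=(w_{e_1}(t),\dots,w_{e_m}(t))\in\mathbb{R}^m_+$ for all $t\in[0,+\infty)$.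
   Context: $\mathbb{R}^m_+=\{(w_1,\dots,w_m)\in\mathbb{R}^m: w_i>0,\ i=1,\dots,m\}$. The graph $(V,E)$ is finite and undirected; each edge $e=xy$ is an unordered pair of distinct vertices, and $z\sim u$ means $zu\in E$. A weight is a vector $\mathbf{w}=(w_{e_1},\dots,w_{e_m})\in\mathbb{R}^m_+$ assigning $w_{e_i}>0$ to the edge $e_i$; we write $w_{xy}=w_e$ if $e=xy$. For $u,v\in V$, the distance is $d(u,v)=\inf_\gamma\sum_{e\in\gamma}w_e$, the infimum over all paths $\gamma$ connecting $u$ and $v$ (so $d(u,u)=0$). For $e=xy\in E$ write $\rho_e=d(x,y)$. For $\alpha\in[0,1]$ and $u\in V$, $\mu_u^\alpha$ is the probability measure on $V$ given by $\mu_u^\alpha(u)=\alpha$, $\mu_u^\alpha(z)=(1-\alpha)\frac{w_{zu}}{\sum_{y\sim u}w_{yu}}$ if $z\sim u$, and $\mu_u^\alpha(z)=0$ otherwise. $W(\mu,\nu)$ is the usual transportation distance between probability measures on $V$: $W(\mu,\nu)=\inf_A\sum_{u,v\in V}A(u,v)d(u,v)$ over all couplings $A:V\times V\to[0,1]$ with $\sum_vA(u,v)=\mu(u)$ and $\sum_uA(u,v)=\nu(v)$. The Lin-Lu-Yau Ricci curvature is, for distinct $u,v\in V$, $$\kappa(u,v)=\lim_{\alpha\to1}\frac{1}{1-\alpha}\left[1-\frac{W(\mu_u^\alpha,\mu_v^\alpha)}{d(u,v)}\right],$$ the limit being taken as $\alpha\to 1$ with $\alpha<1$ (it is known to exist).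 For $e=xy\in E$ write $\kappa_e=\kappa(x,y)$. All of $d,\rho_e,\kappa_e$ depend on the weight $\mathbf{w}$; $\rho_e(t)$ and $\kappa_e(t)$ denote these quantities computed from $\mathbf{w}(t)$. A solution on an interval is a differentiable function of $t$ with values in $\mathbb{R}^m_+$ satisfying the system there. *)

(* Defs.v *)
From HB Require Import structures.
From mathcomp Require Import all_boot all_order all_algebra.
From mathcomp Require Import all_classical all_reals all_analysis.

Set Implicit Arguments.
Unset Strict Implicit.
Unset Printing Implicit Defensive.

Import Order.TTheory GRing.Theory Num.Theory.
Import numFieldNormedType.Exports.

Local Open Scope classical_set_scope.
Local Open Scope ring_scope.

(* The edges are e_i = {src i, tgt i} for i < m; the names src and tgt only fix
   a labelling of the two endpoints, the graph itself is undirected. *)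
Record graph (V : finType) (m : nat) := Graph {
  src : 'I_m -> V;
  tgt : 'I_m -> V;
  src_neq_tgt : forall i, src i != tgt i;
  edge_inj : injective (fun i => [set src i; tgt i]%SET)
}.

Definition edge (V : finType) (m : nat) (G : graph V m) (i : 'I_m) : {set V} :=
  [set src G i; tgt G i]%SET.

Definition adj (V : finType) (m : nat) (G : graph V m) : rel V :=
  fun x y => [exists i, edge G i == [set x; y]%SET].

Definition connected_graph (V : finType) (m : nat) (G : graph V m) : Prop :=
  forall x y, connect (adj G) x y.

Definition positive_weight (R : realType) (m : nat) (w : 'rV[R]_m) : Prop :=
  forall i, 0 < w 0 i.

Section Curvature.
Variables (R : realType) (V : finType) (m : nat) (G : graph V m).
Variable w : 'rV[R]_m.

(* The sum has exactly one term when x and y are adjacent, because edges are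
   pairwise distinct, and is 0 otherwise. *)
Definition wt (x y : V) : R := \sum_(i | edge G i == [set x; y]%SET) w 0 i.

Fixpoint path_length (u : V) (p : seq V) : R :=
  if p is v :: p' then wt u v + path_length v p' else 0.

Definition dist (u v : V) : R :=
  inf [set path_length u p | p in [set p | path (adj G) u p /\ last u p = v]].

Definition mu (alpha : R) (u z : V) : R :=
  if z == u then alpha
  else if adj G z u then (1 - alpha) * (wt z u / \sum_(y | adj G y u) wt y u)
  else 0.

Definition coupling (p q : V -> R) (A : V -> V -> R) : Prop :=
  [/\ forall u v, 0 <= A u v <= 1,
      forall u, \sum_v A u v = p u &
      forall v, \sum_u A u v = q v].

Definition transport_dist (p q : V -> R) : R :=
  inf [set \sum_u \sum_v A u v * dist u v | A in coupling p q].

Definition kappa (u v : V) : R :=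
  lim ((1 - alpha)^-1
         * (1 - transport_dist (mu alpha u) (mu alpha v) / dist u v)
       @[alpha --> 1^'-]).

Definition edge_rho (i : 'I_m) : R := dist (src G i) (tgt G i).

Definition edge_kappa (i : 'I_m) : R := kappa (src G i) (tgt G i).

End Curvature.

(* Derivative relative to D: one-sided at an endpoint of an interval D, the
   usual derivative at an interior point. *)
Definition has_derivative_within (R : realType) (D : set R) (f : R -> R)
    (t l : R) : Prop :=
  (f s - f t) / (s - t) @[s --> within D t^'] --> l.

Definition ricci_flow_on (R : realType) (V : finType) (m : nat) (G : graph V m)
    (I : set R) (w0 : 'rV[R]_m) (w : R -> 'rV[R]_m) : Prop :=
  [/\ w 0 = w0,
      forall t, I t -> positive_weight (w t) &
      forall t i, I t ->
        has_derivative_within I (fun s => w s 0 i) t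
          (- edge_kappa G (w t) i * edge_rho G (w t) i)].

(* Main.v *)
(* Write [F_i = kappa_i * rho_i] for the edge [e_i = xy].  For [alpha >= 1/2] the
   couplings of [mu_x^alpha] and [mu_y^alpha] are exactly the mixtures of the
   couplings at [alpha = 1/2] with the point mass at [(x, y)], so the quotient
   defining [kappa] is constant on [[1/2, 1)] and
   [F_i = 2 (d(x, y) - W(mu_x^(1/2), mu_y^(1/2)))].  Hence [F_i <= 2 w_i], and
   [F_i] is globally Lipschitz on the open positive orthant: when the weights
   change by [delta], the mass to be moved between [x] and a neighbour [u] may
   be large if the weights around [x] are small, but the cost of moving it,
   [|mu(u) - mu'(u)| d(x, u)], is [O(delta)].  Extending [F_i] to a Lipschitz
   field on the whole space that stays below [2 w_i], the Picard-Lindelof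
   theorem gives a global solution, [w_i e^(2t)] is nondecreasing along it, so
   it never leaves the orthant, and Gronwall's inequality gives uniqueness. *)
Require Import Defs.
From mathcomp Require Import all_boot all_order all_algebra.
From mathcomp Require Import all_classical all_reals all_analysis.
From mathcomp Require Import ring lra.

Set Implicit Arguments.
Unset Strict Implicit.
Unset Printing Implicit Defensive.

Import Order.TTheory GRing.Theory Num.Theory.
Import numFieldNormedType.Exports.

Local Open Scope classical_set_scope.
Local Open Scope ring_scope.

(** * Path distances *)

Definition l1dist (R : realType) (m : nat) (w w' : 'rV[R]_m) : R :=
  \sum_j `|w 0 j - w' 0 j|.

Lemma l1dist_ge0 (R : realType) (m : nat) (w w' : 'rV[R]_m) : 0 <= l1dist w w'.
Proof. exact: sumr_ge0. Qed.

Lemma l1distC (R : realType) (m : nat) (w w' : 'rV[R]_m) :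
  l1dist w w' = l1dist w' w.
Proof. by apply: eq_bigr => j _; rewrite distrC. Qed.

Section Graph.
Variables (R : realType) (V : finType) (m : nat) (G : graph V m).

Lemma adjC x y : adj G x y = adj G y x.
Proof. by rewrite /adj finset.setUC. Qed.

Lemma adjxx x : adj G x x = false.
Proof.
apply/existsP => -[i]; rewrite /edge => /eqP e.
have := src_neq_tgt G i; have := set21 (src G i) (tgt G i).
have := set22 (src G i) (tgt G i); rewrite e !inE !orbb.
by move=> /eqP -> /eqP ->; rewrite eqxx.
Qed.

Lemma adj_edge i : adj G (src G i) (tgt G i).
Proof. by apply/existsP; exists i. Qed.

Lemma wtC (w : 'rV[R]_m) x y : wt G w x y = wt G w y x.
Proof. by rewrite /wt finset.setUC. Qed.

Lemma wt_edge (w : 'rV[R]_m) i : wt G w (src G i) (tgt G i) = w 0 i.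
Proof.
rewrite /wt (bigD1 i)//= big1 ?addr0// => j /andP[/eqP ej /negP[]].
by apply/eqP/(@edge_inj _ _ G).
Qed.

Lemma wt_lip (w w' : 'rV[R]_m) x y :
  `|wt G w x y - wt G w' x y| <= l1dist w w'.
Proof.
rewrite /wt -sumrB (le_trans (ler_norm_sum _ _ _))//.
rewrite /l1dist [leRHS](bigID (fun i => edge G i == [set x; y]%SET))/=.
by rewrite lerDl sumr_ge0.
Qed.

Section Positive.
Variables (w : 'rV[R]_m).
Hypothesis w_gt0 : positive_weight w.

Lemma wt_ge0 x y : 0 <= wt G w x y.
Proof. by apply: sumr_ge0 => i _; exact: ltW. Qed.

Lemma wt_gt0 x y : adj G x y -> 0 < wt G w x y.
Proof.
move=> /existsP[i exy]; rewrite /wt (bigD1 i)//= ltr_wpDr//.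
by apply: sumr_ge0 => j _; exact: ltW.
Qed.

Lemma path_length_ge0 x p : 0 <= path_length G w x p.
Proof.
by elim: p x => [|y p IH] x //=; rewrite addr_ge0// wt_ge0.
Qed.

Lemma path_length_cat x p q :
  path_length G w x (p ++ q) = path_length G w x p + path_length G w (last x p) q.
Proof. by elim: p x => [|y p IH] x /=; rewrite ?add0r// IH addrA. Qed.

(** If [x] recurs in the shortened tail, everything up to that occurrence is dropped; nonnegative
    weights make what remains no longer. *)
Lemma simple_path x p : path (adj G) x p ->
  exists q, [/\ path (adj G) x q, last x q = last x p, uniq (x :: q) &
    path_length G w x q <= path_length G w x p].
Proof.
elim: p x => [|y p IH] x /=; first by move=> _; exists [::].
move=> /andP[xy /IH[q [yq <- uq le_q]]].
have [xq|xNq] := boolP (x \in y :: q); last first.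
  exists (y :: q); split => //=; first by rewrite xy yq.
    by rewrite xNq.
  by rewrite lerD2l.
have : path (adj G) x (y :: q) by rewrite /= xy.
have le' : path_length G w x (y :: q) <= wt G w x y + path_length G w y p.
  by rewrite /= lerD2l.
have lastE : last x (y :: q) = last y q by [].
case/splitPr: xq uq lastE le' => q1 q2 uq lastE le' pq.
exists q2; split.
- by move: pq; rewrite cat_path /= => /and3P[].
- by rewrite -lastE last_cat /=.
- by move: uq; rewrite cat_uniq => /and3P[].
- apply: le_trans le'; rewrite path_length_cat /= addrA lerDr.
  by rewrite addr_ge0// ?path_length_ge0 ?wt_ge0.
Qed.

Lemma dist_le_path x p : path (adj G) x p ->
  dist G w x (last x p) <= path_length G w x p.
Proof.
move=> xp; apply: ge_inf; last by exists p.
by exists 0 => _ [q _ <-]; exact: path_length_ge0.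
Qed.

Lemma dist_le_wt x y : adj G x y -> dist G w x y <= wt G w x y.
Proof.
move=> xy; have /dist_le_path : path (adj G) x [:: y] by rewrite /= xy.
by rewrite /= addr0.
Qed.

Lemma distxx_le0 x : dist G w x x <= 0.
Proof. exact: (@dist_le_path x [::]). Qed.

Hypothesis hG : connected_graph G.

(** Connectedness makes the set of path lengths nonempty, so [inf] is a genuine infimum. *)
Lemma le_dist c x y :
  (forall p, path (adj G) x p -> last x p = y -> c <= path_length G w x p) ->
  c <= dist G w x y.
Proof.
move=> h; apply: lb_le_inf; last by move=> _ [p [xp lp] <-]; exact: h.
have /connectP[p xp ->] := hG x y.
by exists (path_length G w x p), p.
Qed.

Lemma dist_ge0 x y : 0 <= dist G w x y.
Proof. by apply: le_dist => p _ _; exact: path_length_ge0. Qed.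

Lemma distxx x : dist G w x x = 0.
Proof. by apply/le_anti; rewrite distxx_le0 dist_ge0. Qed.

Lemma dist_triangle x y z : dist G w x z <= dist G w x y + dist G w y z.
Proof.
rewrite -lerBlDr; apply: le_dist => p xp py.
rewrite lerBlDr addrC -lerBlDr; apply: le_dist => q yq qz.
have := path_length_cat x p q; rewrite py lerBlDr addrC => <-.
have -> : z = last x (p ++ q) by rewrite last_cat py qz.
by apply: dist_le_path; rewrite cat_path xp py.
Qed.

Lemma dist_gt0 x y : x != y -> 0 < dist G w x y.
Proof.
(* A path between distinct vertices has a first edge, whose weight is at least [c]. *)
move=> xy; pose c := \big[Order.min/1]_i w 0 i.
have c_gt0 : 0 < c by apply: lt_bigmin => // i _; exact: w_gt0.
apply: (lt_le_trans c_gt0); apply: le_dist => -[|z p] /=.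
  by move=> _ exy; rewrite exy eqxx in xy.
move=> /andP[/existsP[i exz] _] _.
rewrite (@le_trans _ _ (w 0 i))//; first exact: bigmin_le.
rewrite /wt (bigD1 i)//= -addrA lerDl addr_ge0 ?path_length_ge0//.
by apply: sumr_ge0 => j _; exact: ltW.
Qed.

End Positive.

Lemma path_length_lip (w w' : 'rV[R]_m) x p :
  path_length G w x p <= path_length G w' x p + (size p)%:R * l1dist w w'.
Proof.
elim: p x => [|y p IH] x /=; first by rewrite mul0r addr0.
have := IH y; have := ler_normlW (wt_lip w w' x y).
rewrite -natr1; lra.
Qed.

(* The minimum may be taken over simple paths, which have fewer than [#|V|] edges. *)
Lemma dist_lip (hG : connected_graph G) (w w' : 'rV[R]_m) x y :
  positive_weight w -> positive_weight w' ->
  dist G w x y <= dist G w' x y + #|V|%:R * l1dist w w'.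
Proof.
move=> w0 w'0; rewrite -lerBlDr; apply: le_dist => // p xp py.
have [q [xq qp uq le_q]] := simple_path w'0 xp.
rewrite lerBlDr; apply: le_trans (lerD le_q (lexx _)).
rewrite -py -qp; apply: le_trans (dist_le_path w0 xq) _.
apply: le_trans (path_length_lip w w' x q) _.
rewrite lerD2l ler_wpM2r ?l1dist_ge0// ler_nat.
by apply: ltnW; have := max_card (mem (x :: q)); rewrite (card_uniqP uq).
Qed.

End Graph.

(** * Optimal transport *)

Section OptimalTransport.
Variables (R : realType) (V : finType).
Implicit Types (p q : V -> R) (A D : V -> V -> R).

Definition distribution_on p : Prop := (forall u, 0 <= p u) /\ \sum_u p u = 1.

Definition cost D A : R := \sum_u \sum_v A u v * D u v.

(** The cost function is kept apart from the marginals so that each can be perturbed on its own. *)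
Definition optimal_cost D p q : R := inf [set cost D A | A in coupling p q].

Lemma distribution_le1 p u : distribution_on p -> p u <= 1.
Proof.
by move=> [p0 <-]; rewrite (bigD1 u)//= lerDl sumr_ge0.
Qed.

(** The upper bound 1 in [coupling] is automatic: an entry is at most its row sum. *)
Lemma couplingI p q A : distribution_on p -> (forall u v, 0 <= A u v) ->
  (forall u, \sum_v A u v = p u) -> (forall v, \sum_u A u v = q v) ->
  coupling p q A.
Proof.
move=> dp A0 Ap Aq; split => // u v; rewrite A0/=.
apply: le_trans (distribution_le1 u dp); rewrite -Ap (bigD1 v)//= lerDl.
by rewrite sumr_ge0.
Qed.

Lemma coupling_prod p q : distribution_on p -> distribution_on q ->
  coupling p q (fun u v => p u * q v).
Proof.
move=> dp [q0 q1]; apply: couplingI => //.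
- by move=> u v; rewrite mulr_ge0// dp.1.
- by move=> u; rewrite -mulr_sumr q1 mulr1.
- by move=> v; rewrite -mulr_suml dp.2 mul1r.
Qed.

Lemma cost_ge0 D p q A : (forall u v, 0 <= D u v) -> coupling p q A ->
  0 <= cost D A.
Proof.
move=> D0 [A01 _ _]; apply: sumr_ge0 => u _; apply: sumr_ge0 => v _.
by rewrite mulr_ge0//; case/andP: (A01 u v).
Qed.

Lemma optimal_cost_le D p q A : (forall u v, 0 <= D u v) -> coupling p q A ->
  optimal_cost D p q <= cost D A.
Proof.
move=> D0 cA; apply: ge_inf; last by exists A.
by exists 0 => _ [B cB <-]; exact: cost_ge0 cB.
Qed.

(** The product coupling shows that the infimum is over a nonempty set. *)
Lemma le_optimal_cost D p q c : distribution_on p -> distribution_on q ->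
  (forall A, coupling p q A -> c <= cost D A) -> c <= optimal_cost D p q.
Proof.
move=> dp dq h; apply: lb_le_inf; last by move=> _ [A cA <-]; exact: h.
by exists (cost D (fun u v => p u * q v)), (fun u v => p u * q v) => //;
  exact: coupling_prod.
Qed.

(** Transposing couplings carries estimates for the first marginal over to the second. *)
Lemma optimal_cost_swap D p q : distribution_on p -> distribution_on q ->
  (forall u v, 0 <= D u v) ->
  optimal_cost D p q = optimal_cost (fun u v => D v u) q p.
Proof.
move=> dp dq D0.
have swap (E : V -> V -> R) p' q' : distribution_on p' -> distribution_on q' ->
    (forall u v, 0 <= E u v) ->
    optimal_cost (fun u v => E v u) q' p' <= optimal_cost E p' q'.
  move=> dp' dq' E0; apply: le_optimal_cost => // A [A01 Ap Aq].
  rewrite /cost exchange_big; apply: (@optimal_cost_le _ _ _ (fun u v => A v u)).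
    by [].
  by split.
by apply/le_anti; rewrite !swap.
Qed.

(** A coupling has total mass 1, so adding [c] to the cost function adds exactly [c] to its cost. *)
Lemma optimal_cost_lip D D' p q c : distribution_on p -> distribution_on q ->
  (forall u v, 0 <= D u v) -> (forall u v, D u v <= D' u v + c) ->
  optimal_cost D p q <= optimal_cost D' p q + c.
Proof.
move=> dp dq D0 DD'; rewrite -lerBlDr; apply: le_optimal_cost => // A cA.
rewrite lerBlDr; apply: le_trans (optimal_cost_le D0 cA) _.
have [A01 Ap Aq] := cA.
have <- : cost (fun u v => D' u v + c) A = cost D' A + c.
  rewrite /cost -[in RHS](mulr1 c) -dp.2 mulr_sumr -big_split/=.
  apply: eq_bigr => u _; rewrite -Ap mulr_sumr -big_split/=.
  by apply: eq_bigr => v _; rewrite mulrDr [c * _]mulrC.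
apply: ler_sum => u _; apply: ler_sum => v _; rewrite ler_wpM2l//.
by case/andP: (A01 u v).
Qed.

(* [K u u'] is the fraction of the mass at [u] that is moved to [u']. *)
Lemma optimal_cost_kernel D p p' q (K : V -> V -> R) :
  distribution_on p -> distribution_on p' -> distribution_on q ->
  (forall u v, 0 <= D u v) -> (forall u v z, D u v <= D u z + D z v) ->
  (forall u u', 0 <= K u u') -> (forall u, \sum_u' K u u' = 1) ->
  (forall u', \sum_u p u * K u u' = p' u') ->
  optimal_cost D p' q <=
    optimal_cost D p q + \sum_u p u * \sum_u' K u u' * D u' u.
Proof.
move=> dp dp' dq D0 tri K0 K1 Kp'.
rewrite -lerBlDr; apply: le_optimal_cost => // A [A01 Ap Aq].
have A0 u v : 0 <= A u v by case/andP: (A01 u v).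
(* Composed plan: the share of [p' u'] that came from [u] continues as [A] prescribes for [u]. *)
have cA' : coupling p' q (fun u' v => \sum_u K u u' * A u v).
  apply: couplingI => //.
  - by move=> u' v; apply: sumr_ge0 => u _; rewrite mulr_ge0.
  - move=> u'; rewrite exchange_big/= -Kp'; apply: eq_bigr => u _.
    by rewrite -mulr_sumr Ap mulrC.
  - move=> v; rewrite exchange_big/= -Aq; apply: eq_bigr => u _.
    by rewrite -mulr_suml K1 mul1r.
rewrite lerBlDr; apply: le_trans (optimal_cost_le D0 cA') _.
(* Once all sums carry the weights [K u u' * A u v], the triangle inequality through [u] applies
   termwise. *)
have -> : cost D A = \sum_u \sum_v \sum_u' K u u' * A u v * D u v.
  apply: eq_bigr => u _; apply: eq_bigr => v _.
  by rewrite -!mulr_suml K1 mul1r.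
have -> : \sum_u p u * (\sum_u' K u u' * D u' u) =
    \sum_u \sum_v \sum_u' K u u' * A u v * D u' u.
  apply: eq_bigr => u _; rewrite -Ap mulr_suml; apply: eq_bigr => v _.
  by rewrite mulr_sumr; apply: eq_bigr => u' _; rewrite mulrCA mulrA.
have -> : cost D (fun u' v => \sum_u K u u' * A u v) =
    \sum_u \sum_v \sum_u' K u u' * A u v * D u' v.
  rewrite /cost exchange_big/=.
  under eq_bigr => v _ do (under eq_bigr => u' _ do rewrite mulr_suml; rewrite exchange_big/=).
  by rewrite exchange_big.
rewrite -big_split; apply: ler_sum => u _ /=.
rewrite -big_split; apply: ler_sum => v _ /=.
rewrite -big_split; apply: ler_sum => u' _ /=.
by rewrite -mulrDr addrC ler_wpM2l// mulr_ge0.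
Qed.

(* The excess of [p] over [p'] is sent to [x], and [x] feeds the deficits. *)
Lemma optimal_cost_lazy D p p' q x e :
  distribution_on p -> distribution_on p' -> distribution_on q ->
  p x = 2^-1 -> p' x = 2^-1 ->
  (forall u v, 0 <= D u v) -> (forall u v z, D u v <= D u z + D z v) ->
  (forall u, D u u = 0) ->
  (forall u, `|p u - p' u| * D x u <= e) ->
  (forall u, `|p u - p' u| * D u x <= e) ->
  optimal_cost D p' q <= optimal_cost D p q + #|V|%:R * (e + e).
Proof.
move=> dp dp' dq px p'x D0 tri D00 exu eux.
have [[p0 p1] [p'0 p'1]] := (dp, dp').
pose m u := Num.min (p u) (p' u).
have m0 u : 0 <= m u by rewrite le_min p0 p'0.
have mp u : m u <= p u by rewrite ge_min lexx.
have mp' u : m u <= p' u by rewrite ge_min lexx orbT.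
pose r u := p' u - m u.
have r0 u : 0 <= r u by rewrite subr_ge0.
(* The fraction of [p u] that stays in place; it is 0 by convention where [p u = 0]. *)
pose th u := m u / p u.
have th0 u : 0 <= th u by rewrite divr_ge0.
have pth u : p u * th u = m u.
  have [pu|pu] := eqVneq (p u) 0; last by rewrite mulrC divfK.
  by rewrite pu mul0r; apply/le_anti; rewrite m0 -pu mp.
have th1 u : th u <= 1.
  have [pu|pu] := eqVneq (p u) 0; first by rewrite /th pu invr0 mulr0.
  by rewrite ler_pdivrMr ?mul1r// lt_neqAle eq_sym pu p0.
have sum_ne f : \sum_u f u = 1 -> f x = 2^-1 -> \sum_(u | u != x) f u = 2^-1 :> R.
  by rewrite (bigD1 x)//= => + fx; rewrite fx; lra.
(* The deficits total at most the mass 1/2 of [p'] off [x], which is what [x] has to give. *)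
have sr : \sum_(u | u != x) r u <= 2^-1.
  rewrite -(sum_ne _ p'1 p'x); apply: ler_sum => u _.
  by rewrite lerBlDr lerDl.
(* Since [p x = p' x], deficits and excesses off [x] balance. *)
have mass : \sum_(u | u != x) r u = \sum_(u | u != x) (p u - m u).
  by rewrite !sumrB (sum_ne _ p'1 p'x) (sum_ne _ p1 px).
(* The factor 2 is [(p x)^-1], so that [x] sends exactly the mass [r u'] to [u']. *)
pose K u u' :=
  if u == x then
    if u' == x then 1 - 2 * (\sum_(v | v != x) r v) else 2 * r u'
  else if u' == u then th u else if u' == x then 1 - th u else 0.
have Kxx : K x x = 1 - 2 * (\sum_(v | v != x) r v) by rewrite /K eqxx.
have Kxu u : u != x -> K x u = 2 * r u by rewrite /K eqxx => /negPf ->.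
have Kux u : u != x -> K u x = 1 - th u.
  by rewrite /K => /negPf ux; rewrite ux eq_sym ux eqxx.
have Kuu u : u != x -> K u u = th u by rewrite /K eqxx => /negPf ->.
have Kuv u v : u != x -> v != x -> v != u -> K u v = 0.
  by rewrite /K => /negPf -> /negPf -> /negPf ->.
have mx : m x = 2^-1 by rewrite /m px p'x minxx.
have K0 u v : 0 <= K u v.
  rewrite /K; case: ifP => _; case: ifP => _ //.
  - lra.
  - by rewrite mulr_ge0.
  - by case: ifP => _ //; rewrite subr_ge0.
have sumD (f : V -> V -> R) u : u != x ->
    (forall v, v != x -> v != u -> f u v = 0) ->
    \sum_v f u v = f u u + f u x.
  move=> ux fz; rewrite (bigD1 u)//= (bigD1 x) ?(eq_sym x)//= big1 ?addr0//.
  by move=> v /andP[vu vx]; exact: fz.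
have K1 u : \sum_v K u v = 1.
  have [->|ux] := eqVneq u x.
    rewrite (bigD1 x)//= Kxx; under eq_bigr => v vx do rewrite (Kxu _ vx).
    by rewrite -mulr_sumr subrK.
  rewrite (sumD K _ ux) => [|v vx vu]; last exact: Kuv.
  by rewrite Kuu// Kux// addrC subrK.
have Kp' v : \sum_u p u * K u v = p' v.
  have [->|vx] := eqVneq v x.
    rewrite (bigD1 x)//= Kxx px p'x.
    under eq_bigr => u ux do rewrite (Kux _ ux) mulrBr mulr1 pth.
    by rewrite -mass; lra.
  rewrite (bigD1 x)//= (bigD1 v)//= big1 => [|u /andP[ux uv]]; last first.
    by rewrite Kuv ?mulr0// eq_sym.
  by rewrite Kxu// Kuu// px pth /r addr0; lra.
apply: le_trans (optimal_cost_kernel dp dp' dq D0 tri K0 K1 Kp') _.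
rewrite lerD2l (bigD1 x)//= px.
have -> : \sum_v K x v * D v x = \sum_(v | v != x) 2 * r v * D v x.
  rewrite (bigD1 x)//= D00 mulr0 add0r; apply: eq_bigr => v vx.
  by rewrite Kxu.
have -> : \sum_(u | u != x) p u * (\sum_v K u v * D v u) =
    \sum_(u | u != x) (p u - m u) * D x u.
  apply: eq_bigr => u ux.
  rewrite (sumD (fun u v => K u v * D v u) _ ux); last first.
    by move=> v vx vu; rewrite Kuv// mul0r.
  by rewrite D00 mulr0 add0r Kux// mulrA mulrBr mulr1 pth.
have e0 : 0 <= e by apply: le_trans (exu x); rewrite D00 mulr0.
(* Each vertex off [x] costs at most [e] for its deficit and [e] for its excess. *)
rewrite mulr_sumr -big_split/= [leRHS]mulr_natl -sumr_const.
rewrite [leRHS](bigID (fun u => u != x))/= ler_wpDr//.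
  by apply: sumr_ge0 => *; rewrite addr_ge0.
apply: ler_sum => u _.
have abs1 : r u <= `|p u - p' u|.
  rewrite /r /m; case: (leP (p u) (p' u)) => h; last by rewrite subrr.
  by rewrite distrC ler_norm.
have abs2 : p u - m u <= `|p u - p' u|.
  rewrite /m; case: (leP (p u) (p' u)) => h; first by rewrite subrr.
  by rewrite ler_norm.
rewrite lerD//.
  have -> : 2^-1 * (2 * r u * D u x) = r u * D u x by field.
  by apply: le_trans (eux u); rewrite ler_wpM2r.
by apply: le_trans (exu u); rewrite ler_wpM2r.
Qed.

End OptimalTransport.

(** * Curvature times length *)

Section Curvature.
Variables (R : realType) (V : finType) (m : nat) (G : graph V m).

Definition degree (w : 'rV[R]_m) x : R := \sum_(y | adj G y x) wt G w y x.

Lemma muxx (w : 'rV[R]_m) a x : mu G w a x x = a.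
Proof. by rewrite /mu eqxx. Qed.

Lemma transport_distE (w : 'rV[R]_m) p q :
  transport_dist G w p q = optimal_cost (dist G w) p q.
Proof. by []. Qed.

Lemma degree_lip (w w' : 'rV[R]_m) x :
  `|degree w x - degree w' x| <= #|V|%:R * l1dist w w'.
Proof.
rewrite /degree -sumrB (le_trans (ler_norm_sum _ _ _))//.
rewrite mulr_natl -sumr_const [leRHS](bigID (fun y => adj G y x))/=.
rewrite ler_wpDr//; first by apply: sumr_ge0 => *; exact: l1dist_ge0.
by apply: ler_sum => y _; exact: wt_lip.
Qed.

Section Positive.
Variable w : 'rV[R]_m.
Hypothesis w_gt0 : positive_weight w.

Lemma wt_le_degree x y : adj G y x -> wt G w y x <= degree w x.
Proof.
move=> yx; rewrite /degree (bigD1 y)//= lerDl.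
by apply: sumr_ge0 => z _; exact: wt_ge0.
Qed.

Lemma degree_gt0 x y : adj G y x -> 0 < degree w x.
Proof. by move=> yx; rewrite (lt_le_trans (wt_gt0 w_gt0 yx)) ?wt_le_degree. Qed.

(** A neighbour makes the normalising degree positive, so the neighbours share exactly the mass
    [1 - a]. *)
Lemma distribution_mu a x y : adj G y x -> 0 <= a <= 1 ->
  distribution_on (mu G w a x).
Proof.
move=> yx /andP[a0 a1]; have dx := degree_gt0 yx; split=> [u|].
  rewrite /mu; case: ifP => // _; case: ifP => // _.
  by rewrite mulr_ge0 ?subr_ge0// divr_ge0 ?wt_ge0// ltW.
rewrite (bigD1 x)//= muxx (eq_bigr (fun u => if adj G u x then
    (1 - a) / degree w x * wt G w u x else 0)); last first.
  by move=> u /negPf ux; rewrite /mu ux; case: ifP => // _; rewrite mulrA mulrAC.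
rewrite -big_mkcondr/= (eq_bigl (fun u => adj G u x)) => [|u]; last first.
  by case: eqVneq => // ->; rewrite adjxx.
by rewrite -mulr_sumr divfK ?gt_eqF// addrC subrK.
Qed.

(** [mu] is affine in [a] and is the Dirac mass at [x] for [a = 1]; the formula interpolates between
    the parameters 1/2 and 1. *)
Lemma mu_mix a x u :
  mu G w a x u = 2 * (1 - a) * mu G w 2^-1 x u + (1 - 2 * (1 - a)) * (u == x)%:R.
Proof.
rewrite /mu; case: eqVneq => ux /=; first by field.
by case: ifP => _; rewrite mulr0n ?mulr0 addr0//; set t := _ / _; field.
Qed.

Hypothesis hG : connected_graph G.

(* For [a >= 1/2] every coupling leaves a mass of at least [2a - 1] on [(x, y)];
   removing this mass and rescaling gives all couplings of the measures at [1/2]. *)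
Lemma transport_dist_affine a x y : adj G x y -> 2^-1 <= a < 1 ->
  dist G w x y - transport_dist G w (mu G w a x) (mu G w a y) =
  2 * (1 - a) * (dist G w x y -
    transport_dist G w (mu G w 2^-1 x) (mu G w 2^-1 y)).
Proof.
move=> xy /andP[a2 a1].
have a01 : 0 <= a <= 1 by lra.
have h01 : 0 <= (2^-1 : R) <= 1 by lra.
have yx : adj G y x by rewrite adjC.
have dxa := distribution_mu yx a01; have dya := distribution_mu xy a01.
have dxh := distribution_mu yx h01; have dyh := distribution_mu xy h01.
have xNy : x != y by apply: contraTneq xy => ->; rewrite adjxx.
have D0 := dist_ge0 w_gt0 hG.
pose b := 2 * (1 - a); rewrite -/b.
have b0 : 0 < b by rewrite /b; lra.
have b1 : 0 <= 1 - b by rewrite /b; lra.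
(* The only coupling of the Dirac masses at [x] and [y]. *)
pose P u v : R := ((u == x) && (v == y))%:R.
have P0 u v : 0 <= P u v by rewrite ler0n.
have Px u : \sum_v P u v = (u == x)%:R.
  rewrite /P; case: eqVneq => _ /=; last by rewrite big1.
  by rewrite (bigD1 y)//= eqxx big1 ?addr0// => v /negPf ->.
have Py v : \sum_u P u v = (v == y)%:R.
  rewrite /P; case: (eqVneq v y) => _; last by rewrite big1// => u _; case: (u == x).
  by rewrite (bigD1 x)//= eqxx big1 ?addr0// => u /negPf ->.
have costP : cost (dist G w) P = dist G w x y.
  rewrite /cost (bigD1 x)//= (bigD1 y)//= /P !eqxx mul1r.
  rewrite big1 => [|v /negPf ->]; last by rewrite mul0r.
  by rewrite addr0 big1 ?addr0// => u /negPf ->; rewrite big1// => v _; rewrite mul0r.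
have costD c d A : cost (dist G w) (fun u v => c * A u v + d * P u v) =
    c * cost (dist G w) A + d * dist G w x y.
  rewrite -costP /cost !mulr_sumr -big_split; apply: eq_bigr => u _ /=.
  rewrite !mulr_sumr -big_split; apply: eq_bigr => v _ /=.
  by rewrite mulrDl !mulrA.
rewrite !transport_distE; suff -> : optimal_cost (dist G w) (mu G w a x) (mu G w a y) =
    b * optimal_cost (dist G w) (mu G w 2^-1 x) (mu G w 2^-1 y) + (1 - b) * dist G w x y.
  by ring.
apply/le_anti/andP; split.
  (* Upper bound: a coupling at 1/2 is mixed with [P]. *)
  rewrite -lerBlDr [b * _]mulrC -ler_pdivrMr//; apply: le_optimal_cost => // A [A01 Ax Ay].
  rewrite ler_pdivrMr// [_ * b]mulrC lerBlDr -costD; apply: optimal_cost_le => //.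
  apply: couplingI => //.
  - move=> u v; have /andP[A0 _] := A01 u v.
    by rewrite addr_ge0// mulr_ge0// ltW.
  - by move=> u; rewrite big_split/= -!mulr_sumr Ax Px [RHS]mu_mix.
  - by move=> v; rewrite big_split/= -!mulr_sumr Ay Py [RHS]mu_mix.
(* Lower bound: [(1 - b) * P] is subtracted from a coupling at [a], and the rest is divided by
   [b]. *)
apply: le_optimal_cost => // A [A01 Ax Ay].
have A0 u v : 0 <= A u v by case/andP: (A01 u v).
rewrite -lerBrDr -ler_pdivlMl//.
have -> : b^-1 * (cost (dist G w) A - (1 - b) * dist G w x y) =
    cost (dist G w) (fun u v => b^-1 * A u v + (- (b^-1 * (1 - b))) * P u v).
  by rewrite costD; ring.
have bb : b * b^-1 = 1 by rewrite mulfV// gt_eqF.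
apply: optimal_cost_le => //; apply: couplingI => //.
- move=> u v; rewrite mulNr -mulrA -mulrBr mulr_ge0 ?invr_ge0 ?(ltW b0)// subr_ge0.
  rewrite /P; case: (boolP (_ && _)) => [/andP[/eqP -> /eqP ->]|_]; last by rewrite mulr0.
  rewrite mulr1.
  (* Row [x] puts at most [1 - a] off [y], the mass of the second marginal there, so
     [A x y >= a - (1 - a) = 1 - b]. *)
  have : \sum_(v | v != y) A x v <= \sum_(v | v != y) mu G w a y v.
    apply: ler_sum => z _; rewrite -Ay (bigD1 x)//= lerDl.
    by apply: sumr_ge0.
  have := Ax x; rewrite muxx (bigD1 y)//=.
  have := dya.2; rewrite (bigD1 y)//= muxx /b; lra.
- move=> u; rewrite big_split/= -!mulr_sumr Ax Px (mu_mix a) -/b mulrDr mulrA.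
  by rewrite mulVf ?gt_eqF// mul1r mulNr mulrA addrK.
- move=> u; rewrite big_split/= -!mulr_sumr Ay Py (mu_mix a) -/b mulrDr mulrA.
  by rewrite mulVf ?gt_eqF// mul1r mulNr mulrA addrK.
Qed.

Lemma kappa_dist x y : adj G x y ->
  kappa G w x y * dist G w x y =
  2 * (dist G w x y - transport_dist G w (mu G w 2^-1 x) (mu G w 2^-1 y)).
Proof.
move=> xy; have xNy : x != y by apply: contraTneq xy => ->; rewrite adjxx.
have d0 : dist G w x y != 0 by rewrite gt_eqF// dist_gt0.
set c := RHS.
suff -> : kappa G w x y = c / dist G w x y by rewrite divfK.
apply/cvg_lim => //; apply: (@cvg_trans _ (c / dist G w x y @[_ --> (1 : R)^'-])).
  apply: near_eq_cvg; near=> a.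
  have a2 : 2^-1 <= a < 1.
    apply/andP; split; last by near: a; exact: nbhs_left_lt.
    by near: a; apply: nbhs_left_ge; lra.
  have := transport_dist_affine xy a2.
  move=> e; apply: (mulIf d0); rewrite divfK//.
  rewrite -mulrA mulrBl mul1r divfK// e /c.
  have a1 : 1 - a != 0 by rewrite subr_eq0 gt_eqF//; case/andP: a2.
  by field.
exact: cvg_cst.
Unshelve. all: by end_near. Qed.

End Positive.

Definition speed (w : 'rV[R]_m) (i : 'I_m) : R :=
  edge_kappa G w i * edge_rho G w i.

Hypothesis hG : connected_graph G.

(** Transport cost is nonnegative, and the edge itself is a path of length [w 0 i]. *)
Lemma speed_le (w : 'rV[R]_m) i : positive_weight w -> speed w i <= 2 * w 0 i.
Proof.
move=> w0; rewrite /speed /edge_kappa /edge_rho kappa_dist ?adj_edge//.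
have xy := adj_edge G i; have yx := xy; rewrite adjC in yx.
have h01 : 0 <= (2^-1 : R) <= 1 by lra.
rewrite transport_distE.
have : 0 <= optimal_cost (dist G w) (mu G w 2^-1 (src G i)) (mu G w 2^-1 (tgt G i)).
  apply: le_optimal_cost => [||A cA]; last by apply: (cost_ge0 _ cA); exact: dist_ge0.
  - exact: (distribution_mu w0 yx h01).
  - exact: (distribution_mu w0 xy h01).
have := dist_le_wt w0 xy; rewrite wt_edge; lra.
Qed.

(** The ratio [a / s] alone has no uniform Lipschitz bound for small [s]; the factor [a <= s]
    compensates. *)
Lemma normalized_lip (a a' s s' e : R) : 0 <= a -> 0 <= a' -> 0 < s -> 0 < s' ->
  a <= s -> a' <= s' -> `|a - a'| <= e -> `|s - s'| <= e ->
  `|a / s - a' / s'| * a <= 3 * e.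
Proof.
have key (b b' t t' : R) : 0 <= b -> 0 < t -> 0 < t' -> b <= t -> t <= t' ->
    `|b - b'| <= e -> `|t - t'| <= e -> `|b / t - b' / t'| * b <= 2 * e.
  move=> b0 t0 t'0 bt tt' eb et.
  (* After multiplication by [b], each summand is at most [e], because [b / t'] and [b / t] are at
     most 1. *)
  have -> : b / t - b' / t' = (b - b') / t' + b / t * ((t' - t) / t').
    by field; rewrite !gt_eqF.
  rewrite (le_trans (ler_wpM2r b0 (ler_normD _ _)))// mulrDl.
  have -> : 2 * e = e + e by ring.
  have bt' : b / t' <= 1 by rewrite ler_pdivrMr// mul1r (le_trans bt).
  have bt'0 : 0 <= b / t' by rewrite divr_ge0// ltW.
  have b1 : b / t <= 1 by rewrite ler_pdivrMr// mul1r.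
  have b10 : 0 <= b / t by rewrite divr_ge0// ltW.
  rewrite !normrM !normfV !(gtr0_norm t0) !(gtr0_norm t'0) (ger0_norm b0) lerD//.
    rewrite -mulrA [_^-1 * _]mulrC (le_trans _ eb)//.
    by rewrite ler_piMr.
  rewrite distrC in et.
  have -> : b / t * (`|t' - t| / t') * b = (b / t * (b / t')) * `|t' - t| by ring.
  by rewrite (le_trans _ et)// ler_piMl// mulr_ile1.
move=> a0 a'0 s0 s'0 as_ a's' ea es.
have e0 : 0 <= e by apply: le_trans ea.
have [ss'|/ltW s's] := leP s s'.
  by apply: le_trans (key _ _ _ _ _ _ _ _ ss' ea es) _ => //; lra.
rewrite distrC in ea; rewrite distrC in es.
(* With the roles exchanged, [key] gives the bound [2 * e] for the factor [a']; replacing [a'] by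
   [a] costs at most another [e], as the ratios differ by at most 1. *)
have := key _ _ _ _ a'0 s'0 s0 a's' s's ea es.
have n1 : `|a / s - a' / s'| <= 1.
  have h1 : 0 <= a / s <= 1 by rewrite ler_pdivrMr// mul1r as_ andbT divr_ge0// ltW.
  have h2 : 0 <= a' / s' <= 1 by rewrite ler_pdivrMr// mul1r a's' andbT divr_ge0// ltW.
  by rewrite ler_norml; lra.
rewrite distrC; set n := `|_ - _| in n1 *; have n0 : 0 <= n by exact: normr_ge0.
have /ler_normlP[aa' _] := ea; nra.
Qed.

Lemma mu_lip (w w' : 'rV[R]_m) x u :
  positive_weight w -> positive_weight w' -> adj G u x ->
  `|mu G w 2^-1 x u - mu G w' 2^-1 x u| * wt G w u x <= 3 * (#|V|%:R * l1dist w w').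
Proof.
move=> w0 w'0 ux; have uNx : u != x by apply: contraTneq ux => ->; rewrite adjxx.
rewrite /mu (negPf uNx) ux -mulrBr.
set e := #|V|%:R * _.
(* This lets the same [e] bound the variation of both the weight and the degree. *)
have V1 : 1 <= #|V|%:R :> R by rewrite ler1n; apply/card_gt0P; exists x.
have le_e : l1dist w w' <= e by rewrite ler_peMl// l1dist_ge0.
have h := @normalized_lip (wt G w u x) (wt G w' u x) (degree w x) (degree w' x) e
  (wt_ge0 G w0 _ _) (wt_ge0 G w'0 _ _) (degree_gt0 w0 ux) (degree_gt0 w'0 ux)
  (wt_le_degree w0 ux) (wt_le_degree w'0 ux) (le_trans (wt_lip G w w' u x) le_e)
  (degree_lip w w' x).
apply: le_trans h; rewrite ler_wpM2r ?wt_ge0// normrM ler_piMl//.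
by rewrite ger0_norm; lra.
Qed.

(** The two measures can differ only at neighbours of [x], where the distance is at most the edge
    weight. *)
Lemma mu_dist_lip (w w' : 'rV[R]_m) x u :
  positive_weight w -> positive_weight w' ->
  `|mu G w 2^-1 x u - mu G w' 2^-1 x u| * dist G w x u <= 3 * (#|V|%:R * l1dist w w')
  /\ `|mu G w 2^-1 x u - mu G w' 2^-1 x u| * dist G w u x <= 3 * (#|V|%:R * l1dist w w').
Proof.
move=> w0 w'0; have e0 : 0 <= 3 * (#|V|%:R * l1dist w w').
  by rewrite !mulr_ge0// l1dist_ge0.
have [ux|uNx] := boolP (adj G u x); last first.
  by rewrite /mu (negPf uNx); case: ifP; rewrite subrr normr0 !mul0r.
have h := mu_lip w0 w'0 ux.
have xu := ux; rewrite adjC in xu.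
split; apply: le_trans h; rewrite ler_wpM2l//; last exact: dist_le_wt.
by rewrite wtC dist_le_wt.
Qed.

(** The metric, the first measure and the second measure are replaced in turn, at the costs [#|V|],
    [6 * #|V|^2] and [6 * #|V|^2] times [l1dist w w']. *)
Lemma transport_lip (w w' : 'rV[R]_m) x y :
  positive_weight w -> positive_weight w' -> adj G x y ->
  transport_dist G w' (mu G w' 2^-1 x) (mu G w' 2^-1 y) <=
  transport_dist G w (mu G w 2^-1 x) (mu G w 2^-1 y)
  + (#|V|%:R + 12 * #|V|%:R ^+ 2) * l1dist w w'.
Proof.
move=> w0 w'0 xy; have yx := xy; rewrite adjC in yx.
have h01 : 0 <= (2^-1 : R) <= 1 by lra.
have dx := distribution_mu w0 yx h01; have dx' := distribution_mu w'0 yx h01.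
have dy := distribution_mu w0 xy h01; have dy' := distribution_mu w'0 xy h01.
have D0 := dist_ge0 w0 hG; have D'0 := dist_ge0 w'0 hG.
have tri := dist_triangle w0 hG.
pose D := dist G w; pose e := 3 * (#|V|%:R * l1dist w w').
have s1 := optimal_cost_lip dx' dy' D'0 (fun u v => dist_lip hG u v w'0 w0).
have s2 : optimal_cost D (mu G w' 2^-1 x) (mu G w' 2^-1 y) <=
    optimal_cost D (mu G w 2^-1 x) (mu G w' 2^-1 y) + #|V|%:R * (e + e).
  apply: (@optimal_cost_lazy _ _ _ _ _ _ x) => //; rewrite ?muxx//.
  - by move=> u; apply: (distxx w0 hG).
  - by move=> u; exact: (mu_dist_lip x u w0 w'0).1.
  - by move=> u; exact: (mu_dist_lip x u w0 w'0).2.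
have s3 : optimal_cost D (mu G w 2^-1 x) (mu G w' 2^-1 y) <=
    optimal_cost D (mu G w 2^-1 x) (mu G w 2^-1 y) + #|V|%:R * (e + e).
  rewrite (optimal_cost_swap dx dy)// (optimal_cost_swap dx dy')//.
  apply: (@optimal_cost_lazy _ _ _ _ _ _ y) => //; rewrite ?muxx//.
  - by move=> u v z; rewrite addrC; exact: tri.
  - by move=> u; apply: (distxx w0 hG).
  - by move=> u; exact: (mu_dist_lip y u w0 w'0).2.
  - by move=> u; exact: (mu_dist_lip y u w0 w'0).1.
rewrite !transport_distE; apply: le_trans s1 _; rewrite l1distC -/D.
have -> : (#|V|%:R + 12 * #|V|%:R ^+ 2) * l1dist w w' =
  #|V|%:R * (e + e) + #|V|%:R * (e + e) + #|V|%:R * l1dist w w' by rewrite /e; ring.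
rewrite addrA lerD2r addrA; apply: le_trans s2 _; rewrite lerD2r; exact: s3.
Qed.

Lemma speed_lip (w w' : 'rV[R]_m) i :
  positive_weight w -> positive_weight w' ->
  `|speed w i - speed w' i| <= (4 * #|V|%:R + 24 * #|V|%:R ^+ 2) * l1dist w w'.
Proof.
suff h (u v : 'rV[R]_m) : positive_weight u -> positive_weight v ->
    speed u i - speed v i <= (4 * #|V|%:R + 24 * #|V|%:R ^+ 2) * l1dist u v.
  move=> w0 w'0; apply/ler_normlP; split; last exact: h.
  by rewrite opprB l1distC; exact: h.
move=> u0 v0; rewrite /speed /edge_kappa /edge_rho !kappa_dist ?adj_edge//.
have := dist_lip hG (src G i) (tgt G i) u0 v0.
have := transport_lip u0 v0 (adj_edge G i).
have := l1dist_ge0 u v.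
set l := l1dist u v; set n := #|V|%:R; lra.
Qed.

End Curvature.

(** * Differential equations on the half line *)

Lemma l1dist_triangle (R : realType) (m : nat) (x y z : 'rV[R]_m) :
  l1dist x z <= l1dist x y + l1dist y z.
Proof.
by rewrite /l1dist -big_split; apply: ler_sum => j _; exact: ler_distD.
Qed.

Lemma l1dist_eq0 (R : realType) (m : nat) (x y : 'rV[R]_m) :
  l1dist x y <= 0 -> x = y.
Proof.
move=> xy; apply/rowP => j; apply/eqP; rewrite -subr_eq0 -normr_le0.
apply: le_trans xy; rewrite /l1dist (bigD1 j)//= lerDl.
exact: sumr_ge0.
Qed.

(** McShane's formula: an infimum of functions that are [L]-Lipschitz in [x] is [L]-Lipschitz, and
    the triangle inequality in [S] recovers [f]. *)
Lemma mcshane_extension (R : realType) (m : nat) (S : set 'rV[R]_m)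
    (f : 'rV[R]_m -> R) (L : R) : S !=set0 -> 0 <= L ->
  (forall x y, S x -> S y -> `|f x - f y| <= L * l1dist x y) ->
  exists g : 'rV[R]_m -> R, (forall x y, `|g x - g y| <= L * l1dist x y) /\
    (forall x, S x -> g x = f x).
Proof.
move=> [s0 Ss0] L0 fL; pose E x := [set f s + L * l1dist x s | s in S].
have tri (x y s : 'rV[R]_m) : L * l1dist x s <= L * l1dist x y + L * l1dist y s.
  by rewrite -mulrDr ler_wpM2l// l1dist_triangle.
(* The base point [s0] bounds the set from below, so its infimum is meaningful. *)
have lbE x : lbound (E x) (f s0 - L * l1dist x s0).
  move=> _ [s Ss <-]; have := tri s0 x s; have := fL _ _ Ss0 Ss.
  by rewrite (l1distC s0 x) ler_norml => /andP[_]; lra.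
have infE x s : S s -> inf (E x) <= f s + L * l1dist x s.
  move=> Ss; apply: ge_inf; last by exists s.
  by exists (f s0 - L * l1dist x s0).
have gL x y : inf (E x) - inf (E y) <= L * l1dist x y.
  rewrite lerBlDr addrC -lerBlDr; apply: lb_le_inf.
    by exists (f s0 + L * l1dist y s0), s0.
  by move=> _ [s Ss <-]; have := infE x s Ss; have := tri x y s; lra.
exists (fun x => inf (E x)); split=> [x y|x Sx].
  apply/ler_normlP; split; last exact: gL.
  by rewrite opprB l1distC gL.
apply/le_anti/andP; split.
  apply: le_trans (infE _ _ Sx) _.
  by rewrite /l1dist big1 ?mulr0 ?addr0// => j _; rewrite subrr normr0.
apply: lb_le_inf; first by exists (f s0 + L * l1dist x s0), s0.
by move=> _ [s Ss <-]; have := fL _ _ Sx Ss; rewrite ler_norml => /andP[_]; lra.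
Qed.

(** * Monotonicity, primitives and limits *)

Section HalfLine.
Variable R : realType.
Implicit Types f df : R -> R.

Lemma is_derive1_continuous f (t l : R) : is_derive t 1 f l -> {for t, continuous f}.
Proof.
move=> [ft _]; apply: differentiable_continuous.
exact/derivable1_diffP.
Qed.

Lemma nondecreasing_halfline f df : {within `[0, +oo[, continuous f} ->
  (forall t : R, 0 < t -> is_derive t 1 f (df t)) -> (forall t, 0 < t -> 0 <= df t) ->
  forall t, 0 <= t -> f 0 <= f t.
Proof.
move=> cf fdf df0 t t0.
apply: (@ger0_derive1_ndecry _ f 0) => // s; rewrite in_itv/= andbT => s0.
  by have [] := fdf s s0.
by have [_ fs] := fdf s s0; rewrite derive1E fs; exact: df0.
Qed.

Lemma within_continuous_halfline f df :
  (forall t : R, 0 <= t -> is_derive t 1 f (df t)) -> {within `[0, +oo[, continuous f}.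
Proof.
move=> fdf; apply: derivable_within_continuous => t; rewrite in_itv/= andbT => t0.
by have [] := fdf t t0.
Qed.

Lemma is_derive_expM (K t : R) : is_derive t 1 (fun s => expR (K * s)) (K * expR (K * t)).
Proof.
have h : is_derive t 1 (fun s : R => K * s) K.
  by apply: is_derive_eq; rewrite ?scaler0 ?add0r; exact: mulr1.
have := @is_derive1_comp _ expR (fun s => K * s) t _ _ (is_derive_expR _) h.
by move/is_derive_eq; apply; rewrite mulrC.
Qed.

(** Both [c * expR (K * t) + f t] and [c * expR (K * t) - f t] are nondecreasing and start at
    [c >= 0]; the proof treats them together through a sign [b]. *)
Lemma derivative_bound_expR f df (c K : R) :
  (forall t : R, 0 <= t -> is_derive t 1 f (df t)) -> f 0 = 0 -> 0 <= c ->
  (forall t, 0 <= t -> `|df t| <= c * (K * expR (K * t))) ->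
  forall t, 0 <= t -> `|f t| <= c * expR (K * t).
Proof.
move=> fdf f0 c0 dfc t t0.
have h b (s : R) : 0 <= s -> is_derive s 1
    (fun s => c * expR (K * s) + b * f s) (c * (K * expR (K * s)) + b * df s).
  move=> s0; have := fdf s s0; have := is_derive_expM K s => h1 h2.
  exact: (is_deriveD (is_deriveZ c h1) (is_deriveZ b h2)).
have g b : `|b| = 1 -> 0 <= c * expR (K * t) + b * f t.
  move=> b1; apply: le_trans (_ : 0 <= c * expR (K * 0) + b * f 0) _.
    by rewrite f0 !mulr0 addr0 mulr_ge0// expR_ge0.
  pose F (s : R) := c * expR (K * s) + b * f s.
  have FD (s : R) : 0 < s -> is_derive s 1 F (c * (K * expR (K * s)) + b * df s).
    by move=> s0; exact: h (ltW s0).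
  have cF : {within `[0, +oo[, continuous F} by exact: within_continuous_halfline (h b).
  apply: (nondecreasing_halfline cF FD) t0 => s s0.
  have := dfc s (ltW s0); have : `|b * df s| = `|df s| by rewrite normrM b1 mul1r.
  by move=> <-; rewrite ler_norml => /andP[+ _]; lra.
have := g 1 (normr1 _); have := g (-1) (normrN1 _).
by rewrite ler_norml; lra.
Qed.

Lemma continuous_primitive (g : R -> R) : continuous g ->
  exists f, f 0 = 0 /\ forall t : R, 0 <= t -> is_derive t 1 f (g t).
Proof.
(* Starting the integral at -1 makes 0 an interior point, so the derivative there is two-sided. *)
move=> cg; pose F (x : R) := \int[lebesgue_measure]_(t in `[-1, x]) g t : R.
have FD (t : R) : 0 <= t -> is_derive t 1 F (g t).
  move=> t0; have ig : lebesgue_measure.-integrable `[-1, t + 1] (EFin \o g).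
    apply: continuous_compact_integrable; first exact: segment_compact.
    by apply: continuous_subspaceT => x; exact: cg.
  have [] := @continuous_FTC1_closed _ g (-1) t (t + 1) _ ig _ (cg t).
  - by rewrite ltrDl.
  - by lra.
  move=> dF F1; split; first exact: dF.
  by rewrite -derive1E; exact: F1.
exists (fun t => F t - F 0); split=> [|t t0]; first by rewrite subrr.
have := FD t t0 => h; have := is_deriveB h (is_derive_cst (F 0) t 1).
by rewrite subr0.
Qed.

(* The bound telescopes: [u n - 2 c / 2^n] is nondecreasing and
   [u n + 2 c / 2^n] is nonincreasing. *)
Lemma geometric_limit (u : nat -> R) (c : R) :
  (forall n, `|u n.+1 - u n| <= c / 2 ^+ n) ->
  exists l, forall n, `|l - u n| <= 2 * c / 2 ^+ n.
Proof.
move=> uc; pose e n := 2 * c / 2 ^+ n.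
have eS n : e n = 2 * e n.+1 by rewrite /e exprS; field.
have eh n : c / 2 ^+ n = e n.+1 by rewrite /e exprS; field.
have e0 n : 0 <= e n.
  by rewrite eS -eh mulr_ge0//; exact: le_trans (uc n).
have hu n : `|u n.+1 - u n| <= e n.+1 by rewrite -eh.
have lo n k : u n - e n <= u (n + k)%N - e (n + k)%N.
  elim: k => [|k IH]; first by rewrite addn0.
  apply: le_trans IH _; rewrite addnS; have := hu (n + k)%N.
  by rewrite ler_norml => /andP[+ _]; rewrite (eS (n + k)%N); lra.
have hi n k : u (n + k)%N + e (n + k)%N <= u n + e n.
  elim: k => [|k IH]; first by rewrite addn0.
  apply: le_trans IH; rewrite addnS; have := hu (n + k)%N.
  by rewrite ler_norml => /andP[_ +]; rewrite (eS (n + k)%N); lra.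
have lohi n k : u n - e n <= u k + e k.
  have := lo n k; have := hi k n; rewrite addnC; have := e0 (n + k)%N; lra.
pose S := range (fun n => u n - e n).
(* By [lohi], every upper bound [u k + e k] lies above all of [S]. *)
exists (sup S) => n; rewrite -/(e n) ler_norml; apply/andP; split.
  rewrite lerBrDr addrC; apply: ub_le_sup; last by exists n.
  by exists (u 0 + e 0) => _ [k _ <-].
rewrite lerBlDr addrC; apply: sup_le_ub; first by exists (u 0 - e 0), 0.
by move=> _ [k _ <-].
Qed.

End HalfLine.
Lemma halving_small (R : realType) (M e : R) : 0 < e -> exists n, M / 2 ^+ n < e.
Proof.
move=> e0; have : `|2^-1 : R| < 1 by rewrite ger0_norm; lra.
move=> /(@cvg_geometric R M) /cvgrPdist_lt /(_ e e0) [n _ /(_ n (leqnn n))] /=.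
rewrite sub0r normrN exprVn => h; exists n; exact: le_lt_trans (ler_norm _) h.
Qed.

(** Clamping time at 0 turns continuity at nonnegative times into continuity on the whole line. *)
Lemma continuous_comp_max0 (R : realType) (h : R -> R) (t : R) :
  (forall s : R, 0 <= s -> {for s, continuous h}) ->
  {for t, continuous (fun s : R => h (Num.max s 0))}.
Proof.
move=> ch; apply: (@continuous_comp R R R (fun s : R => Num.max s 0) h t).
  by apply: (@continuous_max _ _ id (cst (0 : R))); [exact: cvg_id|exact: cvg_cst].
by apply: ch; rewrite le_max lexx orbT.
Qed.

(** * Global existence by Picard iteration *)

Section Picard.
Variables (R : realType) (m : nat) (g : 'I_m -> 'rV[R]_m -> R) (L : R).
Hypothesis L0 : 0 <= L.
Hypothesis gL : forall i x y, `|g i x - g i y| <= L * l1dist x y.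

Lemma lipschitz_comp_continuous i (phi : R -> 'rV[R]_m) (t : R) :
  (forall j, {for t, continuous (fun s => phi s 0 j)}) ->
  {for t, continuous (fun s => g i (phi s))}.
Proof.
move=> cphi; have : L * l1dist (phi t) (phi s) @[s --> t] --> L * l1dist (phi t) (phi t).
  apply: cvgMl_tmp; apply: cvg_big => [|j _]; first exact: add_continuous.
   apply: cvg_norm.
  by apply: cvgB; [exact: cvg_cst|exact: cphi].
have -> : l1dist (phi t) (phi t) = 0.
  by rewrite /l1dist big1 // => j _; rewrite subrr normr0.
rewrite mulr0 => /cvgrPdist_lt h; apply/cvgrPdist_lt => e e0.
near=> s; apply: le_lt_trans (gL i _ _) _.
have : `|0 - L * l1dist (phi t) (phi s)| < e by near: s; exact: h.
by rewrite sub0r normrN ger0_norm// mulr_ge0// l1dist_ge0.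
Unshelve. all: by end_near. Qed.

(** Rate of the exponentially weighted (Bielecki) norm: [m * L / K <= 1/2] gives a contraction on
    the whole half line, and the added 1 keeps [K >= 1] even if [L = 0]. *)
Let K : R := 2 * (m%:R * L + 1).

(** Integrating the bound [L * C * expR (K * t)] gains a factor [1 / K] in each of the [m]
    coordinates. *)
Lemma picard_contraction (phi psi a b : R -> 'rV[R]_m) (C : R) : 0 <= C ->
  (forall (t : R) i, 0 <= t -> is_derive t 1 (fun s => phi s 0 i) (g i (a t))) ->
  (forall (t : R) i, 0 <= t -> is_derive t 1 (fun s => psi s 0 i) (g i (b t))) ->
  phi 0 = psi 0 ->
  (forall t : R, 0 <= t -> l1dist (a t) (b t) <= C * expR (K * t)) ->
  forall t : R, 0 <= t -> l1dist (phi t) (psi t) <= C / 2 * expR (K * t).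
Proof.
move=> C0 phiD psiD e0 ab t t0.
have mL : 0 <= m%:R * L by rewrite mulr_ge0.
have K0 : 0 < K by rewrite /K; lra.
have h i : `|phi t 0 i - psi t 0 i| <= L * C / K * expR (K * t).
  apply: (@derivative_bound_expR _ (fun s => phi s 0 i - psi s 0 i)
    (fun s => g i (a s) - g i (b s))) => // [s s0|||s s0].
  - exact: (is_deriveB (phiD s i s0) (psiD s i s0)).
  - by rewrite e0 subrr.
  - by apply: divr_ge0; [exact: mulr_ge0|exact: ltW].
  - apply: le_trans (gL i _ _) _; rewrite mulrA divfK ?gt_eqF// -mulrA.
    by rewrite ler_wpM2l// ab.
apply: le_trans (ler_sum _ (fun i _ => h i)) _.
rewrite sumr_const card_ord -[leLHS]mulr_natl mulrA ler_wpM2r ?expR_ge0//.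
rewrite !mulrA ler_pdivrMr// -[leRHS]mulrA mulrC [C * _]mulrC !mulrA.
by rewrite /K; nra.
Qed.

Lemma picard_step (x0 : 'rV[R]_m) (phi : R -> 'rV[R]_m) :
  (forall (t : R) i, 0 <= t -> {for t, continuous (fun s => phi s 0 i)}) ->
  exists psi : R -> 'rV[R]_m, psi 0 = x0 /\
    forall (t : R) i, 0 <= t -> is_derive t 1 (fun s => psi s 0 i) (g i (phi t)).
Proof.
move=> cphi; pose phi' (t : R) := phi (Num.max t 0).
have cphi' (t : R) i : {for t, continuous (fun s => phi' s 0 i)}.
  apply: (@continuous_comp_max0 _ (fun s => phi s 0 i)) => s s0; exact: cphi.
have /choice[P hP] : forall i, exists f : R -> R, f 0 = 0 /\
    forall t : R, 0 <= t -> is_derive t 1 f (g i (phi' t)).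
  by move=> i; apply: continuous_primitive => t; exact: lipschitz_comp_continuous.
exists (fun t : R => \row_i (P i t + x0 0 i)); split=> [|t i t0].
  by apply/rowP => i; rewrite mxE (hP i).1 add0r.
have -> : (fun s => (\row_i (P i s + x0 0 i)) 0 i) = (fun s => P i s + x0 0 i).
  by apply/funext => s; rewrite mxE.
have := (hP i).2 t t0; rewrite /phi' max_l// => h.
have := is_deriveD h (is_derive_cst (x0 0 i) t 1).
by rewrite addr0.
Qed.

Theorem picard_lindelof (x0 : 'rV[R]_m) : exists w : R -> 'rV[R]_m, w 0 = x0 /\
  forall (t : R) i, 0 <= t -> is_derive t 1 (fun s => w s 0 i) (g i (w t)).
Proof.
have mL : 0 <= m%:R * L by rewrite mulr_ge0.
have K0 : 0 < K by rewrite /K; lra.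
pose good (phi : R -> 'rV[R]_m) :=
  forall (t : R) i, 0 <= t -> {for t, continuous (fun s => phi s 0 i)}.
pose next (phi psi : R -> 'rV[R]_m) := psi 0 = x0 /\
  forall (t : R) i, 0 <= t -> is_derive t 1 (fun s => psi s 0 i) (g i (phi t)).
have next_good phi psi : next phi psi -> good psi.
  by move=> [_ h] t i t0; exact: is_derive1_continuous (h t i t0).
(* Choice needs a total map, so [T] is unconstrained on discontinuous curves. *)
have /choice[T hT] : forall phi, exists psi, good phi -> next phi psi.
  move=> phi; have [gphi|] := pselect (good phi); last by exists phi.
  by have [psi h] := picard_step x0 gphi; exists psi.
pose u n := iter n T (fun=> x0).
have gu n : good (u n).
  elim: n => [|n IH]; first by move=> t i _; exact: cvg_cst.
  exact: next_good (hT _ IH).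
have uS n : next (u n) (u n.+1) by exact: hT.
have u_0 n : u n 0 = x0 by case: n => // n; exact: (uS n).1.
pose C := \sum_i `|g i x0|.
have C0 : 0 <= C by exact: sumr_ge0.
have du n (t : R) : 0 <= t -> l1dist (u n.+1 t) (u n t) <= C / 2 ^+ n * expR (K * t).
  elim: n t => [|n IH] t t0.
    rewrite expr0 divr1 /l1dist /C mulr_suml; apply: ler_sum => i _ /=.
    apply: (@derivative_bound_expR _ (fun s => u 1%N s 0 i - x0 0 i)
      (fun=> g i x0)) => // [s s0||s s0].
    - have := (uS 0%N).2 s i s0 => h; have := is_deriveB h (is_derive_cst (x0 0 i) s 1).
      by rewrite subr0.
    - by rewrite (uS 0%N).1 subrr.
    (* The constant speed [g i x0] fits the exponential bound because [K] and [expR (K * s)] are at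
       least 1. *)
    - rewrite ler_peMr//; have Ks : 0 <= K * s by apply: mulr_ge0 => //; exact: ltW.
      have K1 : 1 <= K by rewrite /K; lra.
      by have := expR_ge1Dx (K * s); nra.
  rewrite exprSr invfM mulrA.
  by apply: (@picard_contraction (u n.+2) (u n.+1) (u n.+1) (u n)) => //;
    rewrite ?u_0 ?divr_ge0 ?exprn_ge0//; [exact: (uS n.+1).2|exact: (uS n).2].
(* Pointwise limit of the iterates, frozen at its initial value for negative times so that
   continuity at 0 is two-sided. *)
have /choice[w hw] : forall t : R, exists l : 'rV[R]_m, forall n i,
    `|l 0 i - u n (Num.max t 0) 0 i| <= 2 * (C * expR (K * Num.max t 0)) / 2 ^+ n.
  move=> t; set t' := Num.max t 0; have t'0 : 0 <= t' by rewrite le_max lexx orbT.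
  have /choice[l hl] : forall i, exists l, forall n,
      `|l - u n t' 0 i| <= 2 * (C * expR (K * t')) / 2 ^+ n.
    move=> i; apply: geometric_limit => n; rewrite mulrAC; apply: le_trans (du n t' t'0).
    by rewrite /l1dist (bigD1 i)//= lerDl sumr_ge0.
  by exists (\row_i l i) => n i; rewrite mxE.
have gw : good w.
  move=> t i t0; pose M := 2 * (C * expR (K * (t + 1))).
  have M0 : 0 <= M by rewrite !mulr_ge0// expR_ge0.
  (* The error is uniform up to time [t + 1], so an [e / 3] argument gives continuity at [t]. *)
  have near_w n s : s <= t + 1 -> `|w s 0 i - u n (Num.max s 0) 0 i| <= M / 2 ^+ n.
    move=> st; apply: le_trans (hw s n i) _.
    rewrite ler_wpM2r ?invr_ge0 ?exprn_ge0// ler_wpM2l// ler_wpM2l//.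
    by rewrite ler_expR ler_wpM2l ?(ltW K0)// ge_max st; lra.
  apply/cvgrPdist_lt => e e0.
  have [n Mn] := halving_small M (divr_gt0 e0 (ltr0Sn _ 2)).
  have cu : {for t, continuous (fun s : R => u n (Num.max s 0) 0 i)}.
    apply: (@continuous_comp_max0 _ (fun s => u n s 0 i)) => s s0; exact: gu.
  near=> s; have st : s <= t + 1 by apply: ltW; near: s; apply: lt_nbhsl; lra.
  have h1 : `|u n (Num.max t 0) 0 i - u n (Num.max s 0) 0 i| < e / 3.
    by near: s; move/cvgrPdist_lt : cu; apply; rewrite divr_gt0.
  have tt : t <= t + 1 by rewrite lerDl.
  have h2 := near_w n t tt.
  have h3 := near_w n s st.
  have Mn' := Mn; move: h1 h2 h3 Mn'; rewrite !ltr_norml !ler_norml.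
  by move=> /andP[? ?] /andP[? ?] /andP[? ?] ?; apply/andP; split; lra.
have [v0 vD] := hT _ gw; set v := T w in v0 vD.
have wu n (t : R) : 0 <= t ->
    l1dist (w t) (u n t) <= 2 * m%:R * C / 2 ^+ n * expR (K * t).
  move=> t0; apply: (@le_trans _ _ (\sum_(i < m) 2 * (C * expR (K * t)) / 2 ^+ n)).
    by apply: ler_sum => i _; have := hw t n i; rewrite max_l.
  rewrite sumr_const card_ord -[leLHS]mulr_natl le_eqVlt; apply/orP; left.
  by apply/eqP; ring.
(* One more Picard step fixes [w]: both curves are within a multiple of [2^-n] of [u n.+1]. *)
have vw (t : R) : 0 <= t -> v t = w t.
  move=> t0; apply: l1dist_eq0; apply/ler_addgt0Pr => e e0; rewrite add0r.
  have [n ne] := halving_small (2 * m%:R * C * expR (K * t)) e0.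
  have D0 k : 0 <= 2 * m%:R * C / 2 ^+ k by rewrite divr_ge0 ?exprn_ge0// !mulr_ge0.
  have := picard_contraction (D0 n) vD (uS n).2 _ (wu n) t0.
  rewrite v0 u_0 => /(_ erefl) h1; have h2 := wu n.+1 t t0.
  apply: le_trans (l1dist_triangle _ (u n.+1 t) _) _.
  apply: le_trans (ltW ne); rewrite [l1dist (u _ _) _]l1distC.
  apply: le_trans (lerD h1 h2) _; rewrite exprS le_eqVlt; apply/orP; left.
  by apply/eqP; field; rewrite expf_neq0.
(* The solution is [v] rather than [w], since [w] is constant at negative times and may lack a
   two-sided derivative at 0. *)
exists v; split=> // t i t0; rewrite vw//; exact: vD.
Unshelve. all: by end_near. Qed.

End Picard.

(** * Relative and two-sided derivatives *)

Section DerivativeWithin.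
Variable R : realType.
Implicit Types (f : R -> R) (t l : R).

Lemma is_derive_within (D : set R) f t l :
  is_derive t 1 f l -> has_derivative_within D f t l.
Proof.
move=> [df fl]; rewrite /has_derivative_within.
apply: (@cvg_trans _ ((f s - f t) / (s - t) @[s --> t^'])).
  exact: cvg_fmap2 (@cvg_within _ _ _ _).
have sub : (s - t) @[s --> t^'] --> 0^'.
  move=> P [e /= e0 he]; exists e => //= s ts sNt.
  apply: he => /=; last by rewrite subr_eq0.
  by rewrite sub0r normrN distrC.
have := cvg_comp _ _ sub df; rewrite -/(derive f t 1) fl.
apply: cvg_trans; apply: near_eq_cvg; near=> s => /=.
rewrite /comp /shift /= [_ *: 1]mulr1 subrK.
exact: mulrC.
Unshelve. all: by end_near. Qed.

Lemma has_derivative_within_is_derive f t l : 0 < t ->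
  has_derivative_within `[0, +oo[ f t l -> is_derive t 1 f l.
Proof.
move=> t0 ftl.
have add : (h + t) @[h --> 0^'] --> within `[0, +oo[ t^'.
  (* Increments smaller than [t] keep [h + t] inside the half line. *)
  move=> P [e /= e0 he]; exists (Num.min e t); first by rewrite /= lt_min e0.
  move=> h /=; rewrite sub0r normrN lt_min => /andP[he' ht] hN0.
  apply: he => /=.
  - by rewrite opprD addrCA subrr addr0 normrN.
  - by rewrite -subr_eq0 addrK.
  - by rewrite in_itv/= andbT; move: ht; rewrite ltr_norml => /andP[+ _]; lra.
have dl : h^-1 *: ((f \o shift t) (h *: 1) - f t) @[h --> 0^'] --> l.
  have := cvg_comp _ _ add ftl.
  apply: cvg_trans; apply: near_eq_cvg; near=> h => /=.
  by rewrite /comp /shift /= [_ *: 1]mulr1 addrK [RHS]mulrC.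
apply: DeriveDef; first by apply/cvg_ex; exists l.
exact/cvg_lim.
Unshelve. all: by end_near. Qed.

Lemma has_derivative_within_right_continuous f l :
  has_derivative_within `[0, +oo[ f 0 l -> f s @[s --> 0^'+] --> f 0.
Proof.
move=> fl.
have sub : (0 : R)^'+ `=>` within `[0, +oo[ (0 : R)^'.
  move=> P [e /= e0 he]; exists e => //= s se s0.
  by apply: he => //; [rewrite gt_eqF|rewrite /= in_itv/= andbT ltW].
have {fl} : (f s - f 0) / (s - 0) @[s --> 0^'+] --> l by exact: cvg_trans (cvg_fmap2 sub) fl.
have : (s : R) @[s --> 0^'+] --> (0 : R).
  by move=> P [e /= e0 he]; exists e => //= s se _; exact: he.
move=> s0 fl.
have h : f 0 + (f s - f 0) / (s - 0) * s @[s --> 0^'+] --> f 0 + l * 0.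
  by apply: cvgD; [exact: cvg_cst|exact: cvgM fl s0].
rewrite mulr0 addr0 in h; apply: cvg_trans h; apply: near_eq_cvg.
near=> s; have s_gt0 : 0 < s by near: s; exact: nbhs_right_gt.
by rewrite /= subr0 divfK ?gt_eqF// addrC subrK.
Unshelve. all: by end_near. Qed.


End DerivativeWithin.

(** * Uniqueness by an energy estimate *)

Lemma within_continuous_sum (R : realType) (n : nat) (A : set R)
    (h : 'I_n -> R -> R) :
  (forall i, {within A, continuous (h i)}) ->
  {within A, continuous (fun s => \sum_i h i s)}.
Proof.
move=> ch x; apply: cvg_big => [|i _]; first exact: add_continuous.
exact: ch.
Qed.

(** The energy [E], a sum of squares and hence differentiable, satisfies [E' <= K * E], so
    [E * expR (- K * t)] cannot rise from its initial value 0. *)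
Lemma gronwall_uniqueness (R : realType) (m : nat)
    (g : 'I_m -> 'rV[R]_m -> R) (L : R) (u v : R -> 'rV[R]_m) :
  0 <= L -> (forall i x y, `|g i x - g i y| <= L * l1dist x y) ->
  (forall i, {within `[0, +oo[, continuous (fun s => u s 0 i)}) ->
  (forall i, {within `[0, +oo[, continuous (fun s => v s 0 i)}) ->
  (forall (t : R) i, 0 < t -> is_derive t 1 (fun s => u s 0 i) (g i (u t))) ->
  (forall (t : R) i, 0 < t -> is_derive t 1 (fun s => v s 0 i) (g i (v t))) ->
  u 0 = v 0 -> forall t : R, 0 <= t -> u t = v t.
Proof.
move=> L0 gL cu cv du dv uv0 t t0.
pose d i s : R := u s 0 i - v s 0 i.
pose d' i s : R := g i (u s) - g i (v s).
pose E s : R := \sum_i d i s ^+ 2.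
pose E' s : R := \sum_i 2 * (d i s * d' i s).
pose K : R := 2 * (m%:R * L).
have dD i (s : R) : 0 < s -> is_derive s 1 (d i) (d' i s).
  by move=> s0; exact: (is_deriveB (du s i s0) (dv s i s0)).
have ED (s : R) : 0 < s -> is_derive s 1 E (E' s).
  move=> s0; have -> : E = \sum_(i < m) (d i * d i).
    by apply/funext => r; rewrite fct_sumE; apply: eq_bigr => i _; rewrite expr2.
  have := is_derive_sum (fun i => is_deriveM (dD i s s0) (dD i s s0)).
  move=> h; apply: is_derive_eq; apply: eq_bigr => i _.
  by rewrite mulr2n mulrDl mul1r.
have expD (s : R) : is_derive s 1 (fun r : R => expR (- K * r)) (- K * expR (- K * s)).
  exact: is_derive_expM.
(* The sign is reversed to fit the monotonicity lemma for nondecreasing functions. *)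
have HD (s : R) : 0 < s -> is_derive s 1 (- (E * (fun r : R => expR (- K * r))))
    (expR (- K * s) * (K * E s - E' s)).
  move=> s0; have := is_deriveN (is_deriveM (ED s s0) (expD s)).
  move/is_derive_eq; apply; rewrite /GRing.scale /=; ring.
have cE : {within `[0, +oo[, continuous (- (E * (fun r : R => expR (- K * r))))}.
  have cd i : {within `[0, +oo[, continuous (d i)}.
    by move=> x; apply: cvgB; [exact: cu|exact: cv].
  have cE' : {within `[0, +oo[, continuous E}.
    apply: within_continuous_sum => i x; apply: cvgM; exact: cd.
  move=> x; apply: cvgN; apply: cvgM; first exact: cE'.
  apply: continuous_subspaceT => {}x.
  exact: is_derive1_continuous (expD x).
have E'le (s : R) : E' s <= K * E s.
  have d'le i : `|d' i s| <= L * \sum_j `|d j s| by exact: gL.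
  (* From [2 * |d_i| * |d_j| <= d_i^2 + d_j^2]; summing over all pairs yields [K = 2 * (m * L)]. *)
  apply: (@le_trans _ _ (\sum_i \sum_j L * (d i s ^+ 2 + d j s ^+ 2))).
    apply: ler_sum => i _; rewrite -mulr_sumr.
    apply: (@le_trans _ _ (2 * (`|d i s| * (L * \sum_j `|d j s|)))).
      rewrite ler_wpM2l// (le_trans (ler_norm _))// normrM ler_wpM2l//.
    rewrite mulrCA mulrA mulrCA -!mulrA ler_wpM2l// !mulr_sumr.
    apply: ler_sum => j _; rewrite -[d i s ^+ 2]real_normK ?num_real//.
    rewrite -[d j s ^+ 2]real_normK ?num_real//.
    by have := sqr_ge0 (`|d i s| - `|d j s|); rewrite sqrrB mulr_natl; lra.
  rewrite le_eqVlt; apply/orP; left; apply/eqP.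
  have -> : \sum_i \sum_j L * (d i s ^+ 2 + d j s ^+ 2) =
      L * \sum_(i < m) (m%:R * d i s ^+ 2 + E s).
    rewrite mulr_sumr; apply: eq_bigr => i _.
    by rewrite -mulr_sumr big_split/= sumr_const card_ord mulr_natl.
  rewrite big_split/= sumr_const card_ord -mulr_sumr -/(E s) -mulr_natl /K; ring.
have E0 : E 0 = 0 by rewrite /E big1// => i _; rewrite /d uv0 subrr expr0n.
have := nondecreasing_halfline cE HD _ t0.
have E'K (s : R) : 0 < s -> 0 <= expR (- K * s) * (K * E s - E' s).
  by move=> s0; rewrite mulr_ge0 ?expR_ge0// subr_ge0.
move=> /(_ E'K).
rewrite [leLHS](_ : _ = 0); last by rewrite /= -[LHS]/(- (E 0 * _)) E0 mul0r oppr0.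
rewrite -[leRHS]/(- (E t * expR (- K * t))) oppr_ge0 pmulr_lle0 ?expR_gt0// => Et.
apply/rowP => i; apply/eqP; rewrite -subr_eq0 -sqrf_eq0 -/(d i t).
rewrite eq_le sqr_ge0 andbT; apply: le_trans Et; rewrite /E (bigD1 i)//= lerDl.
by apply: sumr_ge0 => j _; exact: sqr_ge0.
Qed.

(** * The Ricci flow *)

(* Truncating the extension at [2 w_i] keeps the solutions positive. *)
Lemma speed_extension (R : realType) (V : finType) (m : nat) (G : graph V m) :
  connected_graph G ->
  exists (g : 'I_m -> 'rV[R]_m -> R) (L : R), [/\ 0 <= L,
    forall i x y, `|g i x - g i y| <= L * l1dist x y,
    forall i (x : 'rV[R]_m), - (2 * x 0 i) <= g i x &
    forall i x, positive_weight x -> g i x = - speed G x i].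
Proof.
move=> hG; pose L : R := 4 * #|V|%:R + 24 * #|V|%:R ^+ 2.
have L0 : 0 <= L by rewrite addr_ge0 ?mulr_ge0 ?exprn_ge0.
have /choice[f hf] : forall i, exists f : 'rV[R]_m -> R,
    (forall x y, `|f x - f y| <= L * l1dist x y) /\
    (forall x, positive_weight x -> f x = speed G x i).
  move=> i; apply: (@mcshane_extension _ _ (@positive_weight R m)) => //.
    by exists (const_mx 1) => j; rewrite mxE.
  by move=> x y x0 y0; exact: speed_lip.
(* The constant [L + 2] covers both branches of the minimum, which are [L]- and 2-Lipschitz. *)
exists (fun i x => - Num.min (f i x) (2 * x 0 i)), (L + 2); split.
- by rewrite addr_ge0.
- move=> i x y; have h1 := (hf i).1 x y.
  have h2 : `|x 0 i - y 0 i| <= l1dist x y.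
    by rewrite /l1dist (bigD1 i)//= lerDl sumr_ge0.
  rewrite mulrDl; move: h1 h2; rewrite !ler_norml => /andP[? ?] /andP[? ?].
  by apply/andP; rewrite !minElt; split; do 2! case: ltP => ?; lra.
- by move=> i x; rewrite lerN2 ge_min lexx orbT.
- move=> i x x0; rewrite (hf i).2// min_l//; exact: speed_le.
Qed.

Theorem theorem1p1 (R : realType) (V : finType) (m : nat) (G : graph V m)
    (hG : connected_graph G) (w0 : 'rV[R]_m) (hw0 : positive_weight w0) :
  exists w : R -> 'rV[R]_m,
    ricci_flow_on G `[0, +oo[ w0 w /\
    forall w' : R -> 'rV[R]_m,
      ricci_flow_on G `[0, +oo[ w0 w' ->
      forall t : R, 0 <= t -> w' t = w t.
Proof.
have [g [L [L0 gL g_ge gE]]] := @speed_extension R V m G hG.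
have [w [w_0 wD]] := picard_lindelof L0 gL w0.
have w_cont i : {within `[0, +oo[, continuous (fun s => w s 0 i)}.
  exact: within_continuous_halfline (fun t t0 => wD t i t0).
have w_gt0 t : 0 <= t -> positive_weight (w t).
  move=> t0 i.
  (* The integrating factor [expR (2 * r)] turns the lower bound [- (2 * w_i)] on the field into
     monotonicity. *)
  have D (s : R) : 0 <= s -> is_derive s 1
      ((fun r : R => expR (2 * r)) * (fun r => w r 0 i))
      (expR (2 * s) * (g i (w s) + 2 * w s 0 i)).
    move=> s0; have := is_deriveM (is_derive_expM 2 s) (wD s i s0).
    by move/is_derive_eq; apply; rewrite /GRing.scale /=; ring.
  have D' (s : R) (s0 : 0 < s) := D s (ltW s0).
  have pos (s : R) : 0 < s -> 0 <= expR (2 * s) * (g i (w s) + 2 * w s 0 i).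
    by move=> _; rewrite mulr_ge0 ?expR_ge0// -lerBlDr sub0r.
  have := nondecreasing_halfline (within_continuous_halfline D) D' pos t0.
  rewrite -[leLHS]/(expR (2 * 0) * w 0 0 i) -[leRHS]/(expR (2 * t) * w t 0 i).
  rewrite mulr0 expR0 mul1r w_0 => /(lt_le_trans (hw0 i)).
  by rewrite pmulr_rgt0 ?expR_gt0.
exists w; split=> [|w' [w'_0 w'_gt0 w'D] t t0].
  split=> // [t|t i]; rewrite /= in_itv/= andbT => t0; first exact: w_gt0.
  apply: is_derive_within; rewrite mulNr -/(speed G (w t) i) -gE//; first exact: wD.
  exact: w_gt0.
have in0 (s : R) : 0 <= s -> `[0, +oo[%classic s by rewrite /= in_itv/= andbT.
(* A competing flow is positive by definition, so it solves the extended equation too. *)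
have w'D' (s : R) i : 0 < s -> is_derive s 1 (fun r => w' r 0 i) (g i (w' s)).
  move=> s0; apply: has_derivative_within_is_derive => //.
  have s0' := in0 s (ltW s0); rewrite gE; last exact: w'_gt0.
  by rewrite -mulNr; exact: w'D.
apply: (gronwall_uniqueness L0 gL) t0 => //; last 2 first.
- by move=> s i s0; apply: wD; exact: ltW.
- by rewrite w'_0 w_0.
(* At time 0 the flow [w'] has only a one-sided derivative, which still gives right continuity. *)
move=> i; apply/continuous_within_itvcyP; split.
  move=> s; rewrite in_itv/= andbT => s0; exact: is_derive1_continuous (w'D' s i s0).
exact: has_derivative_within_right_continuous (w'D 0 i (in0 0 (lexx 0))).
Qed.
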